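(* Let $L \hookrightarrow K$ be an inclusion of simplex-wise filtrations $L = (L_1 \hookrightarrow \cdots \hookrightarrow L_n)$ and $K = (K_1 \hookrightarrow \cdots \hookrightarrow K_n)$ of finite simplicial complexes satisfying the standing assumptions listed in the context, let $f$ be a real-valued order-preserving function assigning a filtration value to each simplex of $K_n$, and let $k \ge 0$. Then the collection of triples returned by Algorithm M (described in the context) on input $(L, K, f, k)$ is the mixup barcode of $L \hookrightarrow K$ in degree $k$ (expressed in terms of filtration values).
   Context: All homology is simplicial homology with $\mathbb{Z}_2$ coefficients. **Filtrations and standing assumptions.** $K$ is a filtered finite simplicial complex $K_1 \hookrightarrow K_2 \hookrightarrow \cdots \hookrightarrow K_n$ (with inclusion maps), and similarly $L$: $L_1 \hookrightarrow \cdots \hookrightarrow L_n$; put $L_0 = K_0 = \emptyset$. There is an inclusion $\iota : L \hookrightarrow K$, i.e. $L_i \subseteq K_i$ for every $i$, with $\iota_i : L_i \hookrightarrow K_i$. Both filtrations are simplex-wise: for each $i \ge 0$, $L_{i+1}$ differs from $L_i$ by at most one simplex, and $K_{i+1}$ differs from $K_i$ by at most one simplex. Moreover, each simplex $\sigma$ added in $L_i$ (that is, $\sigma \in L_i\setminus L_{i-1}$) satisfies $\sigma \notin K_{i-1}$. The index of a simplex is the $i$ at which it appears in the filtration; under these assumptions a simplex of $L$ has the same index in $L$ and in $K$, and distinct simplices have distinct indices. We identify a simplex with its index. ''A simplex of $L$'' means a simplex of $L_n$, ''a simplex of $K$'' means a simplex of $K_n$, and $K \setminus L$ denotes the set of simplices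 of $K_n$ not in $L_n$. The function $f$ is order-preserving: if the index of $\sigma$ is at most the index of $\tau$, then $f(\sigma) \le f(\tau)$. **Persistence modules and barcodes.** $H_k(L)$ and $H_k(K)$ denote the persistence modules $H_k(L_1) \to \cdots \to H_k(L_n)$ and $H_k(K_1) \to \cdots \to H_k(K_n)$, and $\operatorname{im}(H_k(\iota))$ is the persistence module $\operatorname{im}(H_k(\iota_1)) \to \cdots \to \operatorname{im}(H_k(\iota_n))$, where $H_k(\iota_i): H_k(L_i)\to H_k(K_i)$ is the induced map. The barcode of a persistence module indexed by $\{1,\dots,n\}$ is the multiset of intervals in its decomposition into interval modules; the interval $\{b, b+1, \dots, d-1\}$ is written $[b,d)$, and an interval containing $n$ is written $[b,\infty)$. For each index $i$ there is at most one interval with minimum $i$ (birth index $i$) in the barcode of $H_k(L)$, and likewise in the barcode of $\operatorname{im}(H_k(\iota))$. There is a canonical surjective matching from the barcode of $H_k(L)$ to the barcode of $\operatorname{im}(H_k(\iota))$, which matches intervals with the same birth index. **Mixup barcode.** The (index) mixup barcode in degree $k$ of $L \hookrightarrow K$ is the collection consisting of a triple $(b,d',d)$ for each pair of matched intervals $[b,d)$ in the barcode of $H_k(L)$ and $[b,d')$ in the barcode of $\operatorname{im}(H_k(\iota))$, and a triple $(b,b,d)$ for each unmatched interval $[b,d)$ in the barcode of $H_k(L)$. The mixup barcode in terms of filtration values is obtained by replacing each finite index in each triple by the value of $f$ on the simplex with that index ($\infty$ is left unchanged). **Reduction.** For a $\mathbb{Z}_2$-matrix with ordered rows and columns, the pivot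 of a nonzero column is the last (largest in the row order) row with a nonzero entry in that column. $\mathrm{REDUCE}$ repeatedly adds columns to columns on their right, modulo 2, until no two nonzero columns have the same pivot; the matrix is replaced by the resulting reduced matrix. For a matrix $M$ and a simplex $\tau$, $M[\tau]$ denotes the column indexed by $\tau$. **Algorithm M** (input $L,K,f,k$): 1. Let $BK$ be the matrix whose columns contain the boundaries of the $k$- and $(k+1)$-simplices of $K$, with rows and columns ordered by the filtration index. 2. Reorder the rows of $BK$ so that the simplices of $L$ come before (have smaller row indices than) the simplices of $K \setminus L$, retaining the relative order among simplices of $L$ and among simplices of $K\setminus L$. 3. Form the matrix $BL$ from $BK$ by zeroing out all entries whose row or column is a simplex of $K \setminus L$. 4. Apply $\mathrm{REDUCE}$ to $BL$ and to $BK$ (from now on $BL$, $BK$ denote the reduced matrices). 5. For each $k$-simplex $\sigma$ of $L$ such that $BL[\sigma] = 0$: set $birth = f(\sigma)$ and $death = death' = \infty$; if there exists $\tau$ such that the pivot of $BL[\tau]$ is $\sigma$, set $death = f(\tau)$; if there exists $\tau'$ such that the pivot of $BK[\tau']$ is $\sigma$, set $death' = f(\tau')$; record the triple $(birth, death', death)$. 6. Return all the recorded triples. *)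

(* Defs.v *)
From HB Require Import structures.
From mathcomp Require Import all_boot all_order all_algebra.
From mathcomp Require Import generic_quotient ring_quotient.
From mathcomp Require Import reals constructive_ereal.

Set Implicit Arguments.
Unset Strict Implicit.
Unset Printing Implicit Defensive.

Import Order.TTheory GRing.Theory Num.Theory.

Local Open Scope ring_scope.
Local Open Scope quotient_scope.

(** * Quotients of finite-dimensional vector spaces *)

Definition quotv (F : fieldType) (vT : vectType F) (U : {vspace vT}) : Type :=
  Quotient.quot (pred_of_vspace U).

HB.instance Definition _ (F : fieldType) (vT : vectType F) (U : {vspace vT}) :=
  GRing.Zmodule.on (quotv U).

Section QuotientVectorSpace.
Variables (F : fieldType) (vT : vectType F) (U : {vspace vT}).
Local Notation Q := (quotv U).

Definition quotv_class (x : vT) : Q := \pi_(Quotient.quot (pred_of_vspace U)) x.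
Definition quotv_repr (q : Q) : vT := repr (q : Quotient.quot (pred_of_vspace U)).

Lemma quotv_reprK : cancel quotv_repr quotv_class.
Proof. exact: reprK. Qed.

Lemma quotv_class_eq x y : (quotv_class x == quotv_class y) = (x - y \in U).
Proof. by rewrite Quotient.idealrBE. Qed.

Lemma quotv_repr_class x : quotv_repr (quotv_class x) - x \in U.
Proof. by rewrite -quotv_class_eq quotv_reprK. Qed.

Lemma quotv_classD x y : quotv_class (x + y) = quotv_class x + quotv_class y.
Proof. exact: (@pi_addr _ _ _ _ _ (Quotient.quot (pred_of_vspace U))). Qed.

Definition quotv_scale (a : F) (q : Q) : Q := quotv_class (a *: quotv_repr q).

Lemma quotv_scale_class a x : quotv_scale a (quotv_class x) = quotv_class (a *: x).
Proof.
by apply/eqP; rewrite quotv_class_eq -scalerBr memvZ ?quotv_repr_class.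
Qed.

Lemma quotv_scaleA a b q : quotv_scale a (quotv_scale b q) = quotv_scale (a * b) q.
Proof. by rewrite -(quotv_reprK q) !quotv_scale_class scalerA. Qed.

Lemma quotv_scale1 : left_id 1 quotv_scale.
Proof. by move=> q; rewrite -(quotv_reprK q) quotv_scale_class scale1r. Qed.

Lemma quotv_scaleDr : right_distributive quotv_scale +%R.
Proof.
move=> a p q; rewrite -(quotv_reprK p) -(quotv_reprK q) -quotv_classD.
by rewrite !quotv_scale_class -quotv_classD scalerDr.
Qed.

Lemma quotv_scaleDl q : {morph quotv_scale^~ q : a b / a + b}.
Proof.
move=> a b; rewrite -(quotv_reprK q).
by rewrite !quotv_scale_class -quotv_classD scalerDl.
Qed.

HB.instance Definition _ := GRing.Zmodule_isLmodule.Build F Q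
  quotv_scaleA quotv_scale1 quotv_scaleDr quotv_scaleDl.

Lemma quotv_class_is_linear : linear quotv_class.
Proof. by move=> a x y; rewrite quotv_classD -quotv_scale_class. Qed.

HB.instance Definition _ :=
  GRing.isLinear.Build F vT Q *:%R quotv_class quotv_class_is_linear.

Lemma quotv_class_eq0 x : (quotv_class x == 0) = (x \in U).
Proof. by rewrite -(linear0 quotv_class) quotv_class_eq subr0. Qed.

Import VectorInternalTheory.

Fact quotv_vect_iso : Vector.axiom (dim (subvs_of U^C)) Q.
Proof.
pose p : 'Hom(vT, vT) := daddv_pi U^C U.
have dU : (U^C :&: U = 0)%VS by rewrite capvC capv_compl.
have pK x : x - p x \in U.
  have xin : x \in (U^C + U)%VS by rewrite addvC addv_complf memvf.
  by rewrite -{1}(daddv_pi_add dU xin) addrC addKr memv_pi.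
have p0 x : x \in U -> p x = 0.
  move=> xU; apply/eqP; rewrite -memv0 -dU memv_cap memv_pi /=.
  by have := memvB xU (pK x); rewrite opprB addrC subrK.
pose g (q : Q) : subvs_of U^C := vsproj U^C (p (quotv_repr q)).
have gc x : g (quotv_class x) = vsproj U^C (p x).
  apply/eqP; rewrite -subr_eq0 -!linearB /= p0 ?quotv_repr_class //.
  by rewrite linear0.
exists (fun q => v2r (g q)).
  move=> a q r; rewrite -(quotv_reprK q) -(quotv_reprK r) -linearP /=.
  by rewrite !gc -!linearP.
exists (fun v => quotv_class (vsval (r2v v : subvs_of U^C))) => [q | v].
  rewrite v2rK vsprojK ?memv_pi //.
  rewrite -[RHS]quotv_reprK; apply/eqP; rewrite quotv_class_eq.
  by rewrite -rpredN opprB pK.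
by rewrite gc daddv_pi_id ?subvsP // vsvalK r2vK.
Qed.

HB.instance Definition _ := Lmodule_hasFinDim.Build F Q quotv_vect_iso.

End QuotientVectorSpace.

(** * Simplicial complexes, filtrations *)

Section Complexes.
Variable V : finType.

Definition simplicial_complex (X : {set {set V}}) : Prop :=
  set0 \notin X /\
  (forall s t : {set V}, s \in X -> t \subset s -> t != set0 -> t \in X).

(* Only the values [K 0], ..., [K n] are meaningful. *)
Definition simplexwise_filtration (n : nat) (K : nat -> {set {set V}}) : Prop :=
  [/\ K 0%N = set0,
      forall i, (i <= n)%N -> simplicial_complex (K i),
      forall i, (i < n)%N -> K i \subset K i.+1
    & forall i, (i < n)%N -> (#|K i.+1 :\: K i| <= 1)%N].

Definition filtration_inclusion (n : nat) (L K : nat -> {set {set V}}) : Prop :=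
  (forall i, (i <= n)%N -> L i \subset K i) /\
  (forall i (s : {set V}), (i < n)%N -> s \in L i.+1 :\: L i -> s \notin K i).

(* The least [i <= n] with [s] in [K i] (and [n.+1] if there is none). *)
Definition simplex_index (n : nat) (K : nat -> {set {set V}}) (s : {set V}) : nat :=
  find (fun i => s \in K i) (iota 0 n.+1).

Definition order_preserving (R : realType) (n : nat) (K : nat -> {set {set V}})
    (f : {set V} -> R) : Prop :=
  {in K n &, forall s t : {set V},
    (simplex_index n K s <= simplex_index n K t)%N -> f s <= f t}.

End Complexes.

(** * Simplicial homology over Z/2 *)

Notation chain V := {ffun {set V} -> ('F_2)^o}.

Section Homology.
Variable V : finType.
Implicit Types (X Y : {set {set V}}) (s t : {set V}) (k : nat).

Definition simplex_chain s : chain V := [ffun t => (t == s)%:R].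

(* The condition [s != set0] makes the boundary of a vertex zero, so that the
   homology is not reduced. *)
Definition facet s t : bool :=
  [&& s != set0, s \subset t & #|t| == #|s|.+1].

Definition simplex_boundary t : chain V := [ffun s => (facet s t)%:R].

Definition boundary : 'End(chain V) :=
  linfun (fun c : chain V => \sum_t c t *: simplex_boundary t).

Definition k_simplices k X : {set {set V}} := [set s in X | #|s| == k.+1].

Definition chains k X : {vspace chain V} :=
  <<[seq simplex_chain s | s <- enum (k_simplices k X)]>>%VS.

Definition cycles k X : {vspace chain V} := (chains k X :&: lker boundary)%VS.

Definition boundaries k X : {vspace chain V} := (boundary @: chains k.+1 X)%VS.

Definition homology k X : vectType 'F_2 :=
  quotv (linfun (vsval : subvs_of (cycles k X) -> chain V)
           @^-1: boundaries k X)%VS.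

(* Meaningful for [z] in [cycles k X]. *)
Definition homology_class k X (z : chain V) : homology k X :=
  quotv_class _ (vsproj (cycles k X) z).

(* The map induced by an inclusion of [X] in [Y], see [homology_mapE]; it has no
   meaning when [X] is not included in [Y]. *)
Definition homology_map k X Y : 'Hom(homology k X, homology k Y) :=
  linfun (fun x : homology k X => homology_class k Y (vsval (quotv_repr x))).

Lemma boundaryE (c : chain V) :
  boundary c = \sum_t c t *: simplex_boundary t.
Proof.
pose g (c : chain V) : chain V := \sum_t c t *: simplex_boundary t.
have gl : linear g.
  move=> a u v; rewrite /g scaler_sumr -big_split /=.
  by apply: eq_bigr => t _; rewrite !ffunE scalerDl scalerA.
pose gL : {linear chain V -> chain V} :=
  HB.pack g (GRing.isLinear.Build _ _ _ _ g gl).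
exact: (lfunE gL).
Qed.

Lemma chainsS k X Y : X \subset Y -> (chains k X <= chains k Y)%VS.
Proof.
move=> sXY; apply: sub_span => _ /mapP[s sX ->]; apply: map_f.
by move: sX; rewrite !mem_enum !inE => /andP[/(subsetP sXY)-> ->].
Qed.

Lemma cyclesS k X Y : X \subset Y -> (cycles k X <= cycles k Y)%VS.
Proof. by move=> sXY; apply: capvS; rewrite ?chainsS. Qed.

Lemma boundariesS k X Y : X \subset Y -> (boundaries k X <= boundaries k Y)%VS.
Proof. by move=> sXY; apply: limgS; apply: chainsS. Qed.

Lemma homology_class_eq k X (y z : chain V) :
    y \in cycles k X -> z \in cycles k X ->
  (homology_class k X y == homology_class k X z) = (y - z \in boundaries k X).
Proof.
move=> yZ zZ; rewrite quotv_class_eq -linearB /= -memv_preim.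
by rewrite lfunE /= vsprojK // memvB.
Qed.

Lemma homology_classP k X (x : homology k X) :
  exists2 z, z \in cycles k X & x = homology_class k X z.
Proof.
exists (vsval (quotv_repr x)); first exact: subvsP.
by rewrite /homology_class vsvalK quotv_reprK.
Qed.

Lemma homology_mapE k X Y (z : chain V) : X \subset Y -> z \in cycles k X ->
  homology_map k X Y (homology_class k X z) = homology_class k Y z.
Proof.
move=> sXY zX.
pose g (x : homology k X) := homology_class k Y (vsval (quotv_repr x)).
have gE c : c \in cycles k X -> g (homology_class k X c) = homology_class k Y c.
  move=> cX; apply/eqP; rewrite /g homology_class_eq; last 2 first.
  - exact: subvP (cyclesS _ sXY) _ (subvsP _).
  - exact: subvP (cyclesS _ sXY) _ cX.
  apply: (subvP (boundariesS k sXY)).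
  rewrite -homology_class_eq ?subvsP //.
  by rewrite /homology_class vsvalK quotv_reprK.
have hcP (W : {set {set V}}) a (c d : chain V) : homology_class k W (a *: c + d)
    = a *: homology_class k W c + homology_class k W d.
  by rewrite /homology_class linearP /= quotv_classD -quotv_scale_class.
have gl : linear g.
  move=> a u v.
  have [y yX ->] := homology_classP u; have [w wX ->] := homology_classP v.
  by rewrite -hcP !gE ?hcP ?memvD ?memvZ.
pose gL : {linear homology k X -> homology k Y} :=
  HB.pack g (GRing.isLinear.Build _ _ _ _ g gl).
by rewrite -gE //; exact: (lfunE gL).
Qed.

End Homology.

(** * Persistence modules and barcodes *)

(* A persistence module indexed by {1, ..., n}: the spaces [pspace i] for
   [1 <= i <= n] and the maps [pmap i] for [1 <= i < n]; what happens at the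
   other indices is ignored. *)
Record pmodule (F : fieldType) := PModule {
  pspace : nat -> vectType F;
  pmap : forall i, 'Hom(pspace i, pspace i.+1)
}.

Section PersistenceModules.
Variable F : fieldType.
Implicit Types M N : pmodule F.

Definition pmodule_zero : pmodule F :=
  @PModule F (fun _ => 'rV[F]_0) (fun _ => 0).

Definition pmodule_sum M N : pmodule F :=
  @PModule F (fun i => (pspace M i * pspace N i)%type)
    (fun i => linfun (fun x : pspace M i * pspace N i =>
                        (pmap M i x.1, pmap N i x.2))).

Definition pmodule_iso (n : nat) M N : Prop :=
  exists phi : forall i, 'Hom(pspace M i, pspace N i),
    (forall i, (1 <= i <= n)%N -> bijective (phi i)) /\
    (forall i, (1 <= i < n)%N -> forall x,
       phi i.+1 (pmap M i x) = pmap N i (phi i x)).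

(* The image of a morphism [phi] from [M] to [N]. *)
Definition pmodule_image M N (phi : forall i, 'Hom(pspace M i, pspace N i)) :
    pmodule F :=
  @PModule F (fun i => subvs_of (limg (phi i)))
    (fun i => linfun (fun x : subvs_of (limg (phi i)) =>
                        vsproj (limg (phi i.+1)) (pmap N i (vsval x)))).

(* [(b, Some d)] is [b,d) = {b, ..., d-1} and [(b, None)] is
   [b,oo) = {b, ..., n}. *)
Definition bar : Type := (nat * option nat)%type.

Definition valid_bar (n : nat) (J : bar) : bool :=
  (1 <= J.1 <= n)%N && (if J.2 is Some d then (J.1 < d <= n)%N else true).

Definition in_bar (J : bar) (i : nat) : bool :=
  (J.1 <= i)%N && (if J.2 is Some d then (i < d)%N else true).

(* The space at [i] is ['rV_1] or ['rV_0] according to whether [i] is in [J], and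
   the all-ones matrix is the identity between two spaces of dimension 1. *)
Definition interval_pmodule (J : bar) : pmodule F :=
  @PModule F (fun i => 'rV[F]_(in_bar J i))
    (fun i => linfun (fun x : 'rV[F]_(in_bar J i) =>
                        x *m (const_mx 1 : 'M[F]_(_, in_bar J i.+1)))).

(* [B] lists, with multiplicities and in some order, the intervals of a
   decomposition of [M] into interval modules. *)
Definition is_barcode (n : nat) M (B : seq bar) : Prop :=
  all (valid_bar n) B /\
  pmodule_iso n M (foldr pmodule_sum pmodule_zero (map interval_pmodule B)).

End PersistenceModules.

(** * The mixup barcode *)

Section MixupBarcode.
Variables (R : realType) (V : finType).
Implicit Types (K L : nat -> {set {set V}}) (f : {set V} -> R).

Definition homology_pmodule k K : pmodule 'F_2 :=
  @PModule 'F_2 (fun i => homology k (K i))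
    (fun i => homology_map k (K i) (K i.+1)).

Definition image_pmodule k L K : pmodule 'F_2 :=
  @pmodule_image _ (homology_pmodule k L) (homology_pmodule k K)
    (fun i => homology_map k (L i) (K i)).

(* Two intervals are matched when they have the same birth index, and a barcode
   of homology or of its image has at most one interval for each birth index;
   the triples are ordered as [(birth, death', death)]. *)
Definition index_mixup_triples (BL Bim : seq bar) :
    seq (nat * option nat * option nat) :=
  [seq (i.1,
        if [seq j <- Bim | j.1 == i.1] is j :: _ then j.2 else Some i.1,
        i.2) | i <- BL].

(* The value of [f] on the simplex with index [i], for those [i] for which there
   is such a simplex. *)
Definition index_value K f (i : nat) : R :=
  if [pick s in K i :\: K i.-1] is Some s then f s else 0.

Definition index_evalue K f (i : option nat) : \bar R :=
  if i is Some j then (index_value K f j)%:E else +oo%E.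

Definition value_triple K f (t : nat * option nat * option nat) :
    R * \bar R * \bar R :=
  (index_value K f t.1.1, index_evalue K f t.1.2, index_evalue K f t.2).

Definition is_mixup_barcode (n : nat) L K f (k : nat)
    (T : seq (R * \bar R * \bar R)) : Prop :=
  exists BL Bim : seq bar,
    [/\ is_barcode n (homology_pmodule k L) BL,
        is_barcode n (image_pmodule k L K) Bim
      & perm_eq T [seq value_triple K f t | t <- index_mixup_triples BL Bim]].

End MixupBarcode.

(** * Matrix reduction *)

(* A matrix over Z/2 whose rows and columns are labelled by elements of [T], as
   the function sending the label of a column to this column; the orders of the
   rows and of the columns are given by sequences of labels, and the entries
   outside these labels are zero. *)
Notation labelled_matrix T := {ffun T -> {ffun T -> ('F_2)^o}}.

Section Reduction.
Variable T : finType.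
Variables rows cols : seq T.
Implicit Types M : labelled_matrix T.

Definition pivot (c : {ffun T -> ('F_2)^o}) : option T :=
  ohead [seq r <- rev rows | c r != 0].

Definition reduced M : bool :=
  [forall s, forall t, [&& s \in cols, t \in cols, s != t, M s != 0 & M t != 0]
     ==> (pivot (M s) != pivot (M t))].

Definition add_column M (s t : T) : labelled_matrix T :=
  [ffun u => if u == t then M t + M s else M u].

(* [reduce M M'] when some run of the reduction of [M] ends with [M']. *)
Inductive reduce M : labelled_matrix T -> Prop :=
| reduce_done : reduced M -> reduce M M
| reduce_step s t M' : ~~ reduced M ->
    (index s cols < index t cols < size cols)%N ->
    reduce (add_column M s t) M' -> reduce M M'.

Lemma pivot_nth M t : pivot (M t) =
  nth None (map Some (rev rows)) (find (fun r => M t r != 0) (rev rows)).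
Proof.
rewrite /pivot; elim: (rev rows) => //= a l IH.
by case: (M t a != 0).
Qed.

Lemma reduce_exists M :
    (forall s t, t \in cols -> M t s != 0 -> s \in rows) ->
  exists M', reduce M M'.
Proof.
pose h (c : {ffun T -> ('F_2)^o}) := find (fun r => c r != 0) (rev rows).
pose m M := (\sum_(t in cols) (size rows - h (M t)))%N.
have [N] := ubnP (m M); elim: N M => // N IH M mN Mrows.
case: (boolP (reduced M)) => [rM | nrM]; first by exists M; left.
have [s [t [/and5P[sc tc nst Ms Mt] pst]]] : exists s t,
    [&& s \in cols, t \in cols, s != t, M s != 0 & M t != 0]
    /\ pivot (M s) == pivot (M t).
  move: (nrM); rewrite negb_forall => /existsP[s]; rewrite negb_forall.
  case/existsP=> t; rewrite negb_imply negbK.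
  by case/andP=> ? ?; exists s, t.
wlog lst : s t sc tc nst Ms Mt pst / (index s cols < index t cols)%N.
  move=> H; case: (ltngtP (index s cols) (index t cols)) => [st | ts | e].
  - exact: (H s t).
  - by apply: (H t s) => //; rewrite eq_sym.
  - by rewrite -(nth_index s sc) e nth_index ?eqxx in nst.
have hlt u : u \in cols -> M u != 0 -> (h (M u) < size (rev rows))%N.
  move=> uc Mu; rewrite -has_find; apply/hasP.
  have [r Mur] : exists r, M u r != 0.
    apply/existsP; apply: contraR Mu; rewrite negb_exists => /forallP Mu.
    by apply/eqP/ffunP=> r; rewrite ffunE; apply/eqP; move: (Mu r); rewrite negbK.
  by exists r => //; rewrite mem_rev (Mrows _ u).
have F2 (x y : 'F_2) : x != 0 -> y != 0 -> x + y = 0.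
  by case: x => [[|[|?]] ?] //; case: y => [[|[|?]] ?] // _ _; apply/eqP.
have lt_h : (h (M t) < h (M t + M s)%R)%N.
  have pE : nth s (rev rows) (h (M s)) = nth s (rev rows) (h (M t)).
    move: pst; rewrite !pivot_nth -!/(h _) !(nth_map s) ?hlt //.
    by move=> /eqP[].
  rewrite ltnNge; apply/negP => le.
  have lts := leq_ltn_trans le (hlt t tc Mt).
  have nz : has (fun r => (M t + M s) r != 0) (rev rows) by rewrite has_find.
  have := nth_find s nz; rewrite -/(h (M t + M s)) ffunE.
  set i := h (M t + M s) in le lts *.
  have hts : h (M s) = h (M t).
    have ps := nth_find s (etrans (has_find _ _) (hlt s sc Ms)).
    have pt := nth_find s (etrans (has_find _ _) (hlt t tc Mt)).
    rewrite -!/(h _) in ps pt.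
    apply/eqP; rewrite eqn_leq; apply/andP; split; rewrite leqNgt; apply/negP=> lh.
      by have := before_find s lh; rewrite -pE ps.
    by have := before_find s lh; rewrite pE pt.
  move: le; rewrite leq_eqVlt => /predU1P[-> | lti].
    rewrite F2 ?eqxx //.
      exact: (nth_find s (etrans (has_find _ _) (hlt t tc Mt))).
    by rewrite -hts; exact: (nth_find s (etrans (has_find _ _) (hlt s sc Ms))).
  have /negbFE/eqP-> := before_find s lti.
  rewrite -hts in lti; have /negbFE/eqP-> := before_find s lti.
  by rewrite addr0 eqxx.
have [] := IH (add_column M s t).
- rewrite ltnS in mN; apply: leq_trans mN; rewrite /m (bigD1 t) //=.
  rewrite [X in (_ < X)%N](bigD1 t) //=.
  rewrite ffunE eqxx -addSn leq_add //.
    by rewrite ltn_sub2l // -size_rev hlt.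
  by apply: leq_sum => u /andP[_ /negbTE nut]; rewrite ffunE nut.
- move=> r u uc; rewrite ffunE; case: (u =P t) => [_ | _]; last exact: Mrows _ _ uc.
  rewrite ffunE; case: (eqVneq (M t r) 0) => [-> | nz _]; last exact: Mrows _ _ tc nz.
  by rewrite add0r; apply: Mrows _ _ sc.
- move=> M' MM'; exists M'; apply: (reduce_step nrM _ MM').
  by rewrite lst index_mem.
Qed.

End Reduction.

(** * The algorithm *)

Section Algorithm.
Variables (R : realType) (V : finType) (n : nat).
Variables (L K : nat -> {set {set V}}) (f : {set V} -> R) (k : nat).

Definition by_index : seq {set V} :=
  sort (fun s t => (simplex_index n K s <= simplex_index n K t)%N) (enum (K n)).

Definition col_order : seq {set V} :=
  [seq s : {set V} <- by_index | (#|s| == k.+1) || (#|s| == k.+2)].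

Definition row_order : seq {set V} :=
  [seq s <- by_index | s \in L n] ++ [seq s <- by_index | s \notin L n].

Definition initial_BK : labelled_matrix {set V} :=
  [ffun t => if t \in col_order then simplex_boundary t else 0].

Definition initial_BL : labelled_matrix {set V} :=
  [ffun t => [ffun s =>
     if (s \in L n) && (t \in L n) then initial_BK t s else 0]].

Definition death_value (B : labelled_matrix {set V}) (s : {set V}) : \bar R :=
  if [pick t in col_order | pivot row_order (B t) == Some s] is Some t
  then (f t)%:E else +oo%E.

Definition algorithmM_output (BL BK : labelled_matrix {set V}) :
    seq (R * \bar R * \bar R) :=
  [seq (f s, death_value BK s, death_value BL s)
     | s : {set V} <- by_index & [&& s \in L n, #|s| == k.+1 & BL s == 0]].

(* [T] is returned by some run of the algorithm. *)
Definition algorithmM_returns (T : seq (R * \bar R * \bar R)) : Prop :=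
  exists BL BK : labelled_matrix {set V},
    [/\ reduce row_order col_order initial_BL BL,
        reduce row_order col_order initial_BK BK
      & T = algorithmM_output BL BK].

End Algorithm.

(* Main.v *)
From HB Require Import structures.
Require Import Defs.
From mathcomp Require Import all_boot all_order all_algebra.
From mathcomp Require Import reals constructive_ereal.

(** Call the last row of a nonzero column its leading row. Left-to-right column
additions keep every span of an initial segment of columns, and in a reduced
matrix distinct columns have distinct leading rows, so a nonzero vector of such
a span has the leading row of one of the columns spanning it.

In the row order of the algorithm, a chain of K whose leading row s lies in L is
a chain of L all of whose simplices have index at most that of s. Let X be L or
K. For every k-simplex s of L with a zero column in BL choose a k-cycle z_s of L
with leading row s, namely the degree k part of the column of BX with pivot s if
there is one. Then the z_s with s in L_i form a basis of Z_k(L_i), and those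
whose column has index at most i form a basis of the intersection of Z_k(L_i)
with B_k(X_i). Hence the classes of the z_s decompose the image of H_k(L) in
H_k(X) into intervals, whose endpoints are the indices of s and of its column.

The degree k part is needed because a run of the reduction may add the column of
a k-simplex to that of a (k+1)-simplex. *)

Set Implicit Arguments.
Unset Strict Implicit.
Unset Printing Implicit Defensive.

Import Order.TTheory GRing.Theory Num.Theory.

Local Open Scope ring_scope.

(** * Barcodes from adapted bases *)

Lemma linfunE (F : fieldType) (aT rT : vectType F) (g : aT -> rT) x :
  linear g -> linfun g x = g x.
Proof.
move=> gl; pose gL : {linear aT -> rT} :=
  HB.pack g (GRing.isLinear.Build _ _ _ _ g gl).
exact: (lfunE gL).
Qed.

Lemma pmodule_sumE (F : fieldType) (M N : pmodule F) i
    (x : pspace M i * pspace N i) :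
  Defs.pmap (pmodule_sum M N) i x = (Defs.pmap M i x.1, Defs.pmap N i x.2).
Proof.
by rewrite [LHS]linfunE // => a u v; rewrite /= !linearP.
Qed.

Lemma interval_pmoduleE (F : fieldType) (J : bar) i (x : 'rV[F]_(in_bar J i)) :
  Defs.pmap (interval_pmodule F J) i x = x *m const_mx 1.
Proof.
by rewrite [LHS]linfunE // => a u v; rewrite mulmxDl scalemxAl.
Qed.

Lemma sum_rV_false (R : pzSemiRingType) (b : bool) (x : 'rV[R]_b) :
  b = false -> \sum_j x 0 j = 0.
Proof. by move: x => /[swap] -> x; rewrite big_ord0. Qed.

Lemma sum_mulmx_ones (R : pzSemiRingType) (b c : bool) (x : 'rV[R]_b) :
  \sum_j (x *m const_mx 1 : 'rV_c) 0 j = if c then \sum_j x 0 j else 0.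
Proof.
case: c; last by rewrite big_ord0.
by rewrite big_ord1 mxE; apply: eq_bigr => j _; rewrite mxE mulr1.
Qed.

Section AdaptedBasis.
Variables (F : fieldType) (M : pmodule F) (E : vectType F).
Variables (q : forall i, 'Hom(E, pspace M i)) (I : eqType) (J : I -> bar) (z : I -> E).

Definition in_death (j : bar) (i : nat) : bool :=
  if j.2 is Some d then (d <= i)%N else false.

Notation bars s := (foldr (@pmodule_sum F) (pmodule_zero F)
  (map (@interval_pmodule F) (map J s))).

(** The morphism from the sum of the intervals to [M] that sends the generator of the bar of [a] to
    [q i (z a)]. Summing the coordinates of a row vector of boolean length reads its only
    coordinate, or gives 0 if there is none, without a case on the dependent type. *)
Fixpoint comb_fun (s : seq I) i : pspace (bars s) i -> pspace M i :=
  if s is a :: s' then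
    fun x : 'rV[F]_(in_bar (J a) i) * pspace (bars s') i =>
      (\sum_c x.1 0 c) *: q i (z a) + comb_fun x.2
  else fun=> 0.

Lemma comb_linear s i : linear (@comb_fun s i).
Proof.
elim: s => [|a s IH] l x y /=; first by rewrite scaler0 addr0.
have -> : \sum_c (l *: x.1 + y.1) 0 c = l * (\sum_c x.1 0 c) + \sum_c y.1 0 c.
  by rewrite mulr_sumr -big_split; apply: eq_bigr => c _; rewrite !mxE.
by rewrite IH scalerDl scalerDr scalerA addrACA.
Qed.

HB.instance Definition _ s i :=
  GRing.isLinear.Build F _ _ _ (@comb_fun s i) (@comb_linear s i).

Lemma dim_bars s i :
  dim (pspace (bars s) i) = count (fun a => in_bar (J a) i) s.
Proof.
elim: s => [|a s IH] /=; first by [].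
rewrite -IH; congr addn.
rewrite -[LHS]/(1 * in_bar (J a) i)%N; by rewrite mul1n.
Qed.

Lemma comb_mem s i a (x : F) : a \in s -> in_bar (J a) i ->
  exists y, @comb_fun s i y = x *: q i (z a).
Proof.
elim: s => //= b s IH; rewrite inE => /predU1P[-> | /IH{}IH] aJ.
  exists (const_mx x, 0) => /=; rewrite (linear0 (@comb_fun s i)) addr0.
  by rewrite aJ big_ord1 mxE.
have [y <-] := IH aJ; exists (0, y) => /=.
by rewrite big1 ?scale0r ?add0r // => c _; rewrite mxE.
Qed.


Variables (n : nat) (s : seq I) (Z : nat -> {vspace E}).
Hypothesis J_valid : all (valid_bar n) (map J s).
Hypothesis z_free : free (map z s).
Hypothesis Z_basis : forall i, (1 <= i <= n)%N ->
  Z i = <<[seq z a | a <- s & ((J a).1 <= i)%N]>>%VS.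
Hypothesis q_ker : forall i, (1 <= i <= n)%N ->
  (Z i :&: lker (q i))%VS = <<[seq z a | a <- s & in_death (J a) i]>>%VS.
Hypothesis q_full : forall i, (1 <= i <= n)%N -> (q i @: Z i)%VS = fullv.
Hypothesis q_map : forall i x, (1 <= i < n)%N -> x \in Z i ->
  Defs.pmap M i (q i x) = q i.+1 x.

Lemma dead_class i a : (1 <= i <= n)%N -> a \in s -> in_death (J a) i ->
  q i (z a) = 0.
Proof.
move=> iP as_ da; have : z a \in (Z i :&: lker (q i))%VS.
  by rewrite q_ker //; apply/memv_span/map_f; rewrite mem_filter da.
by rewrite memv_cap memv_ker => /andP[_ /eqP].
Qed.

(** Outside the bar at [i] both sides vanish; if the bar contains [i] and [i.+1] the square is
    [q_map]; at the last index of the bar the class of [z a] dies by [q_ker]. *)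
Lemma comb_map s' i (x : pspace (bars s') i) : (1 <= i < n)%N ->
  {subset s' <= s} ->
  comb_fun (Defs.pmap (bars s') i x) = Defs.pmap M i (comb_fun x).
Proof.
move=> /andP[i0 lin].
elim: s' x => [|a s' IH] x ss; first by rewrite /= linear0.
rewrite pmodule_sumE /= IH; last by move=> b bs; rewrite ss // inE bs orbT.
rewrite linearD linearZ /=; congr (_ + _).
have as_ : a \in s by rewrite ss ?mem_head.
rewrite interval_pmoduleE sum_mulmx_ones.
have /orP[iJ | /negbTE iJ] := orbN (in_bar (J a) i); last first.
  by rewrite (sum_rV_false _ iJ) if_same !scale0r.
have bi : ((J a).1 <= i)%N by case/andP: iJ.
rewrite q_map ?i0 //; last first.
  rewrite Z_basis ?i0 1?ltnW //; apply/memv_span/map_f.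
  by rewrite mem_filter bi.
have [// | iJ1] := ifPn.
rewrite dead_class ?scaler0 //.
move: iJ1; rewrite /in_bar /in_death (leqW bi).
by case: ((J a).2) => //= d; rewrite -leqNgt.
Qed.

(** A valid bar born by [i] is either alive or dead at [i], never both, and a dead one has been
    born. *)
Lemma count_in_bar i :
  (count (fun a => in_bar (J a) i) s + count (fun a => in_death (J a) i) s =
   count (fun a => (J a).1 <= i) s)%N.
Proof.
rewrite -count_predUI [X in (_ + X)%N](@eq_count _ _ pred0); last first.
  move=> a /=; rewrite /in_bar /in_death.
  by case: (J a).2 => [d|]; rewrite ?andbF //; case: ltnP; rewrite ?andbF.
rewrite count_pred0 addn0; apply: eq_in_count => a as_ /=.
have /andP[_] := allP J_valid _ (map_f J as_); rewrite /in_bar /in_death.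
case: (J a).2 => [d|] /=; last by rewrite orbF andbT.
move=> /andP[bd _]; case: ltnP => [|di]; first by rewrite orbF andbT.
by rewrite orbT (leq_trans (ltnW bd)).
Qed.

Lemma dim_filtered (p : pred I) :
  \dim <<[seq z a | a <- s & p a]>> = count p s.
Proof.
have /eqP -> : free [seq z a | a <- s & p a]; last by rewrite size_map size_filter.
apply: (@catl_free _ _ [seq z a | a <- s & predC p a]).
by rewrite -map_cat (perm_free (perm_map _ (permEl (perm_filterC p s)))).
Qed.

(** Rank-nullity for [q i] on [Z i]: the bars born by [i] count the dimension of [Z i], the dead
    ones that of the kernel. *)
Lemma dim_pspace i : (1 <= i <= n)%N ->
  dim (pspace M i) = count (fun a => in_bar (J a) i) s.
Proof.
move=> iP; rewrite -dimvf -(q_full iP).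
have := limg_ker_dim (q i) (Z i); rewrite q_ker // Z_basis // !dim_filtered.
by rewrite -count_in_bar addnC => /addIn ->.
Qed.

(** It suffices to reach the classes of the vectors [z a] spanning [Z i]: those of a bar alive at
    [i] come from its generator, the others are 0. *)
Lemma comb_surj i x : (1 <= i <= n)%N -> exists y, @comb_fun s i y = x.
Proof.
move=> iP; pose f := linfun (@comb_fun s i).
suff: x \in limg f by case/memv_imgP=> y _ ->; exists y; rewrite lfunE.
have : x \in (q i @: Z i)%VS by rewrite q_full ?memvf.
rewrite Z_basis // limg_span; apply/subvP/span_subvP => _ /mapP[_ /mapP[a + ->] ->].
rewrite mem_filter => /andP[bi as_].
case iJ: (in_bar (J a) i).
  have [y ey] := comb_mem 1 as_ iJ; rewrite scale1r in ey.
  by rewrite -ey -(lfunE (@comb_fun s i)) memv_img ?memvf.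
rewrite dead_class ?mem0v //.
move: iJ; rewrite /in_bar /in_death bi.
by case: ((J a).2) => //= d; rewrite ltnNge => /negbFE.
Qed.

(** The combination maps are onto and the dimensions agree, so they are isomorphisms, natural by
    [comb_map]. *)
Lemma barcode_of_adapted_basis : is_barcode n M (map J s).
Proof.
split=> //.
pose f i := linfun (@comb_fun s i).
have fi i : (1 <= i <= n)%N -> lker (f i) == 0%VS /\ limg (f i) = fullv.
  move=> iP; have ff : limg (f i) = fullv.
    apply/eqP; rewrite eqEsubv subvf; apply/subvP=> x _.
    by have [y <-] := comb_surj x iP; rewrite -(lfunE (@comb_fun s i)) memv_img ?memvf.
  split=> //; have := limg_ker_dim (f i) fullv.
  rewrite ff !dimvf capfv dim_pspace // -dim_bars => /eqP.
  by rewrite -[X in _ == X]add0n eqn_add2r dimv_eq0.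
have fK i : (1 <= i <= n)%N -> cancel (f i) (f i)^-1%VF.
  by move=> /fi[/lker0_lfunK].
have fKV i : (1 <= i <= n)%N -> cancel (f i)^-1%VF (f i).
  by move=> /fi[_ ff] x; rewrite limg_lfunVK ?ff ?memvf.
(* [pmodule_iso] starts from [M], so the inverses of the combination maps are taken. *)
exists (fun i => (f i)^-1%VF); split=> [i iP | i iP x].
  by exists (f i); [exact: fKV | exact: fK].
have iP' : (1 <= i <= n)%N by case/andP: iP => -> /ltnW.
have iP1 : (1 <= i.+1 <= n)%N by case/andP: iP.
apply: (can_inj (fK _ iP1)); rewrite fKV //.
by rewrite lfunE /= comb_map // -(lfunE (@comb_fun s i)) fKV.
Qed.
End AdaptedBasis.

(** * Leading rows and column reduction *)

Section LeadingTerms.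
Variables (F : fieldType) (T : finType) (rho : T -> nat).
Hypothesis rho_inj : injective rho.
Implicit Types (c v : {ffun T -> F^o}) (r : T).

Definition leading c r : bool :=
  (c r != 0) && [forall s, (c s != 0) ==> (rho s <= rho r)%N].

Lemma leadingP c r :
  reflect (c r != 0 /\ forall s, c s != 0 -> (rho s <= rho r)%N) (leading c r).
Proof.
apply: (iffP andP) => -[cr /= h]; split=> //; last by apply/'forall_implyP.
exact/'forall_implyP.
Qed.

Lemma leading_neq0 c r : leading c r -> c != 0.
Proof. by case/leadingP=> + _; apply: contraNneq => ->; rewrite ffunE. Qed.

Lemma leading_exists c : c != 0 -> exists r, leading c r.
Proof.
move=> c0; have [r0 r0P] : exists r, c r != 0.
  apply/existsP; apply: contraR c0; rewrite negb_exists => /forallP c0.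
  by apply/eqP/ffunP=> r; rewrite ffunE; apply/eqP; rewrite -[_ == _]negbK.
case: (arg_maxnP rho (P := fun r => c r != 0) r0P) => r cr rmax.
by exists r; apply/leadingP; split.
Qed.

Lemma leading_uniq c r r' : leading c r -> leading c r' -> r = r'.
Proof.
move=> /leadingP[cr rm] /leadingP[cr' rm'].
by apply/rho_inj/eqP; rewrite eqn_leq rm ?rm'.
Qed.

Lemma leadingZ a c r : a != 0 -> leading (a *: c) r = leading c r.
Proof.
move=> a0; have aE s : ((a *: c) s != 0) = (c s != 0).
  by rewrite ffunE mulf_eq0 (negbTE a0).
by rewrite /leading aE; congr andb; apply: eq_forallb => s; rewrite aE.
Qed.

Lemma leadingD c c' r r' : leading c r -> leading c' r' -> (rho r < rho r')%N ->
  leading (c + c') r'.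
Proof.
move=> /leadingP[cr rm] /leadingP[cr' rm'] lt; apply/leadingP; split.
  rewrite ffunE; case: (eqVneq (c r') 0) => [-> | /rm]; first by rewrite add0r.
  by rewrite leqNgt lt.
move=> s; rewrite ffunE; case: (eqVneq (c s) 0) => [-> | /rm + _].
  by rewrite add0r; exact: rm'.
by move=> sr; rewrite (leq_trans sr) // ltnW.
Qed.

Definition distinct_leading (I : eqType) (A : seq I) (v : I -> {ffun T -> F^o}) :=
  {in A &, forall s t r, leading (v s) r -> leading (v t) r -> s = t}.

(** Leading entries cannot cancel: the multiple of the first vector and the combination of the
    others have distinct leading rows, and the later one leads the sum. *)
Lemma leading_span (I : eqType) (A : seq I) (v : I -> {ffun T -> F^o}) c :
    uniq A -> distinct_leading A v ->
    c \in <<map v A>>%VS -> c != 0 ->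
  exists s r, [/\ s \in A, leading (v s) r & leading c r].
Proof.
elim: A c => [|x A IH] c /=.
  by rewrite span_nil memv0 => _ _ ->.
move=> /andP[xA uA] dA; rewrite span_cons => /memv_addP[_ /vlineP[a ->] [c' c'A ->]].
have dA' : distinct_leading A v.
  by move=> s t sA tA; apply: dA; rewrite inE ?sA ?tA orbT.
have inA s : s \in A -> s \in x :: A by rewrite inE orbC => ->.
have {}IH := IH c' uA dA' c'A.
case: (eqVneq (a *: v x) 0) => [-> | avx].
  by rewrite add0r => /IH[s [r [sA vs cr]]]; exists s, r; split; rewrite ?inA.
have a0 : a != 0 by apply: contraNneq avx => ->; rewrite scale0r.
have [r vr] := leading_exists avx.
have vr' : leading (v x) r by rewrite leadingZ in vr.
case: (eqVneq c' 0) => [-> | /IH[s [r' [sA vs cr']]]].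
  by rewrite addr0 => _; exists x, r; split; rewrite ?mem_head.
move=> _; case: (ltngtP (rho r) (rho r')) => [lt | lt | /rho_inj e].
- by exists s, r'; split; rewrite ?inA // (leadingD vr).
- by exists x, r; split; rewrite ?mem_head // addrC (leadingD cr').
- have xs : x = s by apply: (dA x s _ _ r); rewrite ?mem_head ?inA // e.
  by rewrite xs sA in xA.
Qed.

(** A vector in the span of the ones after it would share its leading row with one of them. *)
Lemma leading_free (I : eqType) (A : seq I) (v : I -> {ffun T -> F^o}) :
    uniq A -> distinct_leading A v -> {in A, forall s, v s != 0} ->
  free (map v A).
Proof.
elim: A => [|x A IH] /=; first by rewrite nil_free.
move=> /andP[xA uA] dA nz; have inA s : s \in A -> s \in x :: A by rewrite inE orbC => ->.
have dA' : distinct_leading A v by move=> s t sA tA; apply: dA; rewrite inA.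
rewrite free_cons IH // ?andbT => [|s /inA]; last exact: nz.
apply: contra xA => vx.
have [s [r [sA vs vr]]] := leading_span uA dA' vx (nz _ (mem_head _ _)).
by rewrite (dA x s (mem_head _ _) (inA _ sA) r).
Qed.

(** Gaussian elimination by induction on the leading row: subtracting a multiple of [v] cancels the
    leading entry, and [v \in U] keeps the remainder in [U]. *)
Lemma span_leading (U : {vspace {ffun T -> F^o}}) (X : seq {ffun T -> F^o}) :
    (forall c r, c \in U -> leading c r ->
       exists v, [/\ v \in X, v \in U & leading v r]) ->
  (U <= <<X>>)%VS.
Proof.
move=> UX; apply/subvP=> c.
have [-> | /leading_exists[r cr]] := eqVneq c 0; first by rewrite !mem0v.
have [N] := ubnP (rho r); elim: N c r cr => // N IH c r cr rN cU.
have [v [vX vU vr]] := UX c r cU cr.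
have /leadingP[vr0 vm] := vr; have /leadingP[cr0 cm] := cr.
pose c' := c - (c r / v r) *: v.
have c'U : c' \in U by rewrite memvB ?memvZ.
have -> : c = c' + (c r / v r) *: v by rewrite subrK.
rewrite memvD ?memvZ ?(memv_span vX) //.
have [e0 | /leading_exists[r' c'r]] := eqVneq c' 0; first by rewrite e0 mem0v.
apply: (IH _ _ c'r _ c'U); rewrite ltnS in rN; apply: leq_trans rN.
have /leadingP[c'r0 _] := c'r.
have c'E s : c' s = c s - c r / v r * v s by rewrite !ffunE.
have c'0 : c' r = 0 by rewrite c'E divfK ?subrr.
rewrite ltn_neqAle; apply/andP; split.
  by apply: contra c'r0 => /eqP/rho_inj ->; rewrite c'0.
case: (eqVneq (c r') 0) => [c0 | /cm //].
case: (eqVneq (v r') 0) => [v0 | /vm //].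
by rewrite c'E c0 v0 mulr0 subr0 eqxx in c'r0.
Qed.

End LeadingTerms.

Section ColumnReduction.
Variable T : finType.
Variables (rows cols : seq T).
Implicit Types (M : labelled_matrix T) (c : {ffun T -> ('F_2)^o}).

(* Appending [enum T] makes the rank injective on all of [T]. *)
Definition row_rank (r : T) : nat := index r (rows ++ enum T).

Lemma row_rank_inj : injective row_rank.
Proof.
move=> r s e; have mem t : t \in rows ++ enum T by rewrite mem_cat mem_enum orbT.
by rewrite -(nth_index r (mem r)) -[index _ _]/(row_rank r) e nth_index.
Qed.

Lemma pivotP c r : uniq rows -> (forall s, c s != 0 -> s \in rows) ->
  (pivot rows c == Some r) = leading row_rank c r.
Proof.
move=> urows sub.
have pl x : pivot rows c = Some x -> leading row_rank c x.
  (* Applied to [rev rows]: [R1] holds the rows after [x], all zero in [c], and [R2] those before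
     [x], in reverse. *)
  have cat_filter (R : seq T) : ohead [seq s <- R | c s != 0] = Some x ->
      exists R1 R2, [/\ R = R1 ++ x :: R2, c x != 0 & ~~ has (fun s => c s != 0) R1].
    elim: R => //= y R IH; case: ifP => [cy [<-] | cy /IH[R1 [R2 [-> cx hR]]]].
      by exists [::], R.
    by exists (y :: R1), R2; rewrite /= cy.
  move=> /cat_filter[R1 [R2 [e cx hR]]]; apply/leadingP; split=> // s cs.
  have srows := sub s cs; rewrite /row_rank !index_cat srows sub //.
  move: e urows srows => /(canRL (@revK _)) ->.
  rewrite rev_cat rev_cons cat_rcons => uR.
  rewrite mem_cat inE !mem_rev => /or3P[sR2 | /eqP-> // | sR1].
    rewrite !index_cat !mem_rev sR2; case: ifP => xR2.
      move: uR; rewrite cat_uniq => /and3P[_ /hasPn/(_ x)]; rewrite mem_head.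
      by rewrite mem_rev xR2 => /(_ isT).
    by rewrite (leq_trans (index_size _ _)) ?leq_addr.
  by case/negP: hR; apply/hasP; exists s.
apply/eqP/idP=> [/pl // | cr].
case e: (pivot rows c) => [x|]; first by rewrite (leading_uniq row_rank_inj (pl x e) cr).
have /leadingP[cr0 _] := cr; move: e; rewrite /pivot.
have : r \in [seq s <- rev rows | c s != 0] by rewrite mem_filter cr0 mem_rev sub.
by case: [seq s <- rev rows | c s != 0].
Qed.

Variable idx : T -> nat.
Hypothesis idx_cols : {in cols &, forall s t,
  (index s cols < index t cols)%N -> (idx s < idx t)%N}.

(** The initial segment is cut by [idx] and not by position, so that it can be compared with the
    complexes of a filtration. *)
Definition colspan M i : {vspace {ffun T -> ('F_2)^o}} :=
  <<[seq M u | u <- cols & (idx u < i)%N]>>%VS.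

Lemma mem_colspan M i u : u \in cols -> (idx u < i)%N -> M u \in colspan M i.
Proof. by move=> uc ui; apply/memv_span/map_f; rewrite mem_filter ui. Qed.

Lemma colspan_subv M i (U : {vspace {ffun T -> ('F_2)^o}}) :
  (forall u, u \in cols -> (idx u < i)%N -> M u \in U) -> (colspan M i <= U)%VS.
Proof.
by move=> h; apply/span_subvP=> _ /mapP[u + ->]; rewrite mem_filter => /andP[? /h]; apply.
Qed.

(** The addition is undone by subtracting column [s], which lies in each segment that contains
    column [t]. *)
Lemma add_column_colspan M s t i : s \in cols -> t \in cols -> (idx s < idx t)%N ->
  colspan (add_column M s t) i = colspan M i.
Proof.
move=> sc tc st; have nst : s != t by apply: contraTneq st => ->; rewrite ltnn.
apply/eqP; rewrite eqEsubv; apply/andP; split; apply: colspan_subv => u uc ui.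
  rewrite ffunE; case: eqP => [e | _]; last exact: mem_colspan.
  by rewrite memvD ?mem_colspan // -?e // (ltn_trans st) -?e.
case: (eqVneq u t) => [e | nut]; last first.
  have -> : M u = add_column M s t u by rewrite ffunE (negbTE nut).
  exact: mem_colspan.
have -> : M u = add_column M s t t - add_column M s t s.
  by rewrite !ffunE eqxx (negbTE nst) addrK e.
by rewrite memvB ?mem_colspan -?e // (ltn_trans st) -?e.
Qed.

(** The last clause, used in [reduced_col_eq0], holds because only earlier columns are ever added to
    a column. *)
Lemma reduce_colspan M M' : reduce rows cols M M' ->
  [/\ reduced rows cols M', forall i, colspan M' i = colspan M i
    & {in cols, forall t, M' t - M t \in colspan M (idx t)}].
Proof.
elim=> {M M'} [M rM | M s t M' _ /andP[st tc] _ [rM' eqM' diffM']].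
  by split=> // t _; rewrite subrr mem0v.
rewrite index_mem in tc; have sc : s \in cols.
  by rewrite -index_mem (ltn_trans st) ?index_mem.
have ist := idx_cols sc tc st; split=> // [i | u uc].
  by rewrite eqM' add_column_colspan.
rewrite -(subrK (add_column M s t u) (M' u)) -addrA memvD //.
  by rewrite -(add_column_colspan _ _ sc tc ist) diffM'.
rewrite ffunE; case: eqP => [-> | _]; last by rewrite subrr mem0v.
by rewrite addrC addKr mem_colspan.
Qed.

Lemma reduced_distinct_leading M i :
    uniq rows -> reduced rows cols M ->
    (forall t s, t \in cols -> M t s != 0 -> s \in rows) ->
  distinct_leading row_rank [seq u <- cols | (idx u < i)%N] M.
Proof.
move=> urows rM Mrows s t; rewrite !mem_filter => /andP[_ sc] /andP[_ tc] r ls lt.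
apply: contraTeq (isT) => nst; move/forallP/(_ s)/forallP/(_ t): rM.
rewrite sc tc nst (leading_neq0 ls) (leading_neq0 lt) /=.
rewrite -!(pivotP _ urows) in ls lt; try by move=> x; apply: Mrows.
by rewrite (eqP ls) (eqP lt) eqxx.
Qed.

End ColumnReduction.

(** * Chains and simplex indices *)

Section Chains.
Variable V : finType.
Implicit Types (X Y : {set {set V}}) (s t : {set V}) (c : chain V).

Lemma simplex_chainE s t : simplex_chain s t = (t == s)%:R.
Proof. by rewrite ffunE. Qed.

Lemma chain_sum c : c = \sum_s c s *: simplex_chain s.
Proof.
apply/ffunP=> t; rewrite sum_ffunE (bigD1 t) //= big1 ?addr0 => [|s st].
  by rewrite ffunE simplex_chainE eqxx [RHS]mulr1.
by rewrite ffunE simplex_chainE eq_sym (negbTE st) [LHS]mulr0.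
Qed.

Lemma mem_simplex_span (A : seq {set V}) c :
  reflect (forall s, c s != 0 -> s \in A) (c \in <<map (@simplex_chain V) A>>%VS).
Proof.
apply: (iffP idP) => [cA s | h]; last first.
  rewrite [c]chain_sum; apply: memv_suml => s _.
  have [-> | /h sA] := eqVneq (c s) 0; first by rewrite scale0r mem0v.
  by rewrite memvZ // memv_span // map_f.
apply: contraR => sA; rewrite (coord_span (X := in_tuple _) cA) sum_ffunE big1 // => i _.
have /mapP[t tA ->] : (map (@simplex_chain V) A)`_i \in map (@simplex_chain V) A.
  exact: mem_nth.
rewrite ffunE simplex_chainE (_ : (s == t) = false) ?[LHS]mulr0 //.
by apply: contraNF sA => /eqP->.
Qed.

Lemma mem_chains k X c :
  reflect (forall s, c s != 0 -> s \in X /\ #|s| = k.+1) (c \in chains k X).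
Proof.
apply: (iffP (mem_simplex_span _ _)) => h s /h; rewrite mem_enum inE.
  by case/andP=> -> /eqP.
by case=> -> ->; rewrite eqxx.
Qed.

Lemma boundary_coef c s : boundary V c s = \sum_(t | facet s t) c t.
Proof.
rewrite boundaryE sum_ffunE [RHS]big_mkcond; apply: eq_bigr => t _.
by rewrite !ffunE; case: facet; rewrite [LHS](mulr1, mulr0).
Qed.

Lemma boundary_support X c s : simplicial_complex X ->
  (forall t, c t != 0 -> t \in X) -> boundary V c s != 0 ->
  exists t, [/\ t \in X, c t != 0, facet s t & s \in X].
Proof.
move=> [_ XS] cX; rewrite boundary_coef => cs.
have [t /andP[st ct]] : exists t, facet s t && (c t != 0).
  apply/existsP; apply: contraR cs; rewrite negb_exists => /forallP h.
  rewrite big1 // => t st; apply/eqP; move: (h t); rewrite st /=.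
  by rewrite negbK.
have /and3P[s0 sst _] := st; exists t; split=> //; first exact: cX.
exact: XS (cX t ct) sst s0.
Qed.

Lemma boundary_simplex t : boundary V (simplex_chain t) = simplex_boundary t.
Proof.
apply/ffunP=> s; rewrite boundary_coef ffunE.
have [st | nst] := boolP (facet s t).
  rewrite (bigD1 t) //= simplex_chainE eqxx big1 ?addr0 // => u /andP[_ ut].
  by rewrite simplex_chainE (negbTE ut).
by rewrite big1 // => u su; rewrite simplex_chainE; case: eqP su nst => // -> ->.
Qed.

(** These sets are [s] with one of the two elements of [t :\: s] added. *)
Lemma card_between s t : s \subset t -> #|t| = #|s|.+2 ->
  #|[set u : {set V} | [&& s \subset u, u \subset t & #|u| == #|s|.+1]]| = 2.
Proof.
move=> st ct; have <- : #|[set x |: s | x in t :\: s]| = 2.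
  rewrite card_in_imset.
    by rewrite cardsD (setIidPr st) ct subSn ?leqnSn ?subSnn.
  move=> x y /setDP[xt xs] /setDP[yt ys] /setP/(_ x).
  by rewrite !inE eqxx (negbTE xs) !orbF => /esym/eqP.
apply: eq_card => u; rewrite inE; apply/and3P/imsetP => [[su ut cu] | [x xts ->]].
  have : #|u :\: s| = 1%N by rewrite cardsD (setIidPr su) (eqP cu) subSnn.
  move/eqP/cards1P=> [x ux]; exists x.
    have : x \in u :\: s by rewrite ux inE.
    by rewrite !inE => /andP[-> /(subsetP ut)].
  by rewrite -ux -[LHS](setID u s) (setIidPr su) setUC.
move: xts; rewrite inE => /andP[xs xt].
by rewrite subsetUr subUset sub1set xt st cardsU1 xs.
Qed.

(** The coefficient at [s] of the double boundary of [t] counts the [u] between them: there are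
    none, or two, which is 0 in ['F_2]. *)
Lemma boundary_boundary c : boundary V (boundary V c) = 0.
Proof.
rewrite [c]chain_sum linear_sum linear_sum big1 // => t _.
rewrite linearZ /= linearZ /= boundary_simplex; suff -> : boundary V (simplex_boundary t) = 0.
  exact: scaler0.
apply/ffunP=> s; rewrite boundary_coef !ffunE.
under eq_bigr do rewrite ffunE.
rewrite -natr_sum -[X in X%:R]/(\sum_(u | facet s u) if facet u t then 1 else 0)%N.
rewrite -big_mkcondr /= sum1dep_card.
have [/and3P[s0 st /eqP ct] | nst] := boolP [&& s != set0, s \subset t & #|t| == #|s|.+2].
  rewrite (_ : #|_| = 2); first exact/eqP.
  rewrite -(card_between st ct); apply: eq_card => u; rewrite !inE /facet s0 ct /=.
  case: (s \subset u); case: (u \subset t); rewrite ?andbF //=.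
  case: (#|u| =P #|s|.+1) => // cu; rewrite cu eqxx andbT -cards_eq0 cu //.
rewrite (_ : #|_| = 0%N) //; apply/eqP; rewrite cards_eq0; apply: contraR nst.
case/set0Pn=> u; rewrite inE => /andP[/and3P[s0 su /eqP cu] /and3P[_ ut /eqP ct]].
by rewrite s0 (subset_trans su ut) ct cu eqxx.
Qed.

(** The parameter is the number of vertices, one more than the dimension: [degree_part k.+1] keeps
    the k-simplices. *)
Definition degree_part k c : chain V := [ffun s : {set V} => if #|s| == k then c s else 0].

Lemma degree_part_is_linear k : linear (degree_part k).
Proof.
move=> a u v; apply/ffunP=> s; rewrite !ffunE.
by case: ifP => _ //; rewrite addr0 [RHS]mulr0.
Qed.

HB.instance Definition _ k :=
  GRing.isLinear.Build _ _ _ _ (degree_part k) (degree_part_is_linear k).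

(** A simplex has one vertex more than each of its facets. *)
Lemma boundary_degree_part k c :
  boundary V (degree_part k.+1 c) = degree_part k (boundary V c).
Proof.
apply/ffunP=> s; rewrite boundary_coef [RHS]ffunE boundary_coef.
case: ifP => sk; last rewrite [LHS]big1 //; last first.
  by move=> t /and3P[_ _ /eqP ct]; rewrite ffunE ct eqSS sk.
by apply: eq_bigr => t /and3P[_ _ /eqP ct]; rewrite ffunE ct eqSS sk.
Qed.

End Chains.

Section Indices.
Variables (V : finType) (n : nat).
Implicit Types (K L : nat -> {set {set V}}) (s t : {set V}).

Lemma filtrationS K i j : simplexwise_filtration n K ->
  (i <= j <= n)%N -> K i \subset K j.
Proof.
move=> [_ _ KS _] /andP[ij jn]; elim: j ij jn => [|j IH].
  by rewrite leqn0 => /eqP->.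
rewrite leq_eqVlt => /predU1P[-> // | ij jn].
by rewrite (subset_trans (IH _ _) (KS _ _)) // ltnW.
Qed.

Lemma mem_filtration K s i : simplexwise_filtration n K -> s \in K n ->
  (i <= n)%N -> (s \in K i) = (simplex_index n K s <= i)%N.
Proof.
move=> hK sK le_in; rewrite /simplex_index.
set p := fun j => s \in K j.
have hp : has p (iota 0 n.+1).
  by apply/hasP; exists n; rewrite ?mem_iota /p ?add0n ?ltnS ?leqnn.
apply/idP/idP => [si | le].
  rewrite leqNgt; apply/negP=> lt; have := before_find 0%N lt.
  by rewrite nth_iota // add0n /p si.
have := nth_find 0%N hp; rewrite nth_iota; last first.
  by rewrite ltnS (leq_trans le).
by rewrite add0n; apply/subsetP/(filtrationS hK); rewrite le.
Qed.

Lemma simplex_index_le K s : simplexwise_filtration n K -> s \in K n ->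
  (simplex_index n K s <= n)%N.
Proof. by move=> hK sK; rewrite -mem_filtration. Qed.

Lemma simplex_index_gt0 K s : simplexwise_filtration n K -> s \in K n ->
  (0 < simplex_index n K s)%N.
Proof.
move=> hK sK; rewrite ltnNge -mem_filtration //.
by case: hK => -> _ _ _; rewrite inE.
Qed.

Lemma mem_step K s : simplexwise_filtration n K -> s \in K n ->
  s \in K (simplex_index n K s) :\: K (simplex_index n K s).-1.
Proof.
move=> hK sK; have i0 := simplex_index_gt0 hK sK; have le := simplex_index_le hK sK.
have le' := leq_trans (leq_pred _) le.
rewrite inE (mem_filtration hK sK le') (mem_filtration hK sK le) leqnn andbT.
by rewrite -ltnNge ltn_predL.
Qed.

Lemma step_uniq K s t : simplexwise_filtration n K -> s \in K n ->
  t \in K (simplex_index n K s) :\: K (simplex_index n K s).-1 -> t = s.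
Proof.
move=> hK sK tK; have sS := mem_step hK sK.
have i0 := simplex_index_gt0 hK sK; have le := simplex_index_le hK sK.
case: hK => _ _ _ /(_ (simplex_index n K s).-1); rewrite prednK // => /(_ le).
by move/card_le1_eqP; apply.
Qed.

Lemma simplex_index_inj K : simplexwise_filtration n K ->
  {in K n &, injective (simplex_index n K)}.
Proof.
by move=> hK s t sK tK e; apply: (step_uniq hK) => //; rewrite -e mem_step.
Qed.

Lemma index_value_step (R : realType) K (f : {set V} -> R) s :
  simplexwise_filtration n K -> s \in K n ->
  index_value K f (simplex_index n K s) = f s.
Proof.
move=> hK sK; rewrite /index_value; case: pickP => [t /(step_uniq hK sK) -> // |].
by move/(_ s); rewrite mem_step.
Qed.

(** A simplex in [K i] but not in [L i] would enter [L] after step [i] although already in [K],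
    against [filtration_inclusion]. So indices in [K] serve for [L] as well. *)
Lemma mem_subfiltration L K s i : simplexwise_filtration n L ->
    simplexwise_filtration n K -> filtration_inclusion n L K ->
  s \in L n -> (i <= n)%N -> (s \in L i) = (simplex_index n K s <= i)%N.
Proof.
move=> hL hK [LK newLK] sL le_in.
have sK : s \in K n by apply: (subsetP (LK n _)).
rewrite -(mem_filtration hK) //; apply/idP/idP; first by apply: (subsetP (LK _ _)).
apply: contraTT => sLi.
have i0 := simplex_index_gt0 hL sL; have le := simplex_index_le hL sL.
have ij : (i <= (simplex_index n L s).-1)%N.
  by rewrite -ltnS prednK // ltnNge -(mem_filtration hL).
have := newLK (simplex_index n L s).-1 s; rewrite prednK // mem_step // => /(_ le isT).
have le' := leq_trans (leq_pred _) le.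
by apply/contra/subsetP/(filtrationS hK); rewrite ij.
Qed.

End Indices.

(** * The reduced matrices *)

Section Orders.
Variables (V : finType) (n : nat) (L K : nat -> {set {set V}}).
Hypothesis hK : simplexwise_filtration n K.
Implicit Types s t : {set V}.
Local Notation idx := (simplex_index n K).

Lemma by_index_uniq : uniq (by_index n K).
Proof. by rewrite sort_uniq enum_uniq. Qed.

Lemma mem_by_index s : (s \in by_index n K) = (s \in K n).
Proof. by rewrite mem_sort mem_enum. Qed.

Lemma index_by_index (p : pred {set V}) :
  let B := [seq s <- by_index n K | p s] in
  {in B &, forall s t, (index s B <= index t B)%N -> (idx s <= idx t)%N}.
Proof.
move=> B; have Bsorted : sorted (relpre idx leq) B.
  apply: sorted_filter; first by move=> x y z; apply: leq_trans.
  by apply: sort_sorted => x y; apply: leq_total.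
apply: (sorted_leq_index (leT := relpre idx leq)) => //.
  by move=> x y z; apply: leq_trans.
by move=> x; apply: leqnn.
Qed.

Lemma mem_col_order k s : (s \in col_order n K k) =
  ((#|s| == k.+1) || (#|s| == k.+2)) && (s \in K n).
Proof. by rewrite mem_filter mem_by_index. Qed.

Lemma col_order_lt k : {in col_order n K k &, forall s t,
  (index s (col_order n K k) < index t (col_order n K k))%N -> (idx s < idx t)%N}.
Proof.
move=> s t sc tc lt; rewrite ltn_neqAle (index_by_index sc tc (ltnW lt)) andbT.
apply: contraTneq lt => /(simplex_index_inj hK) ->; first by rewrite ltnn.
  by move: sc; rewrite mem_col_order => /andP[].
by move: tc; rewrite mem_col_order => /andP[].
Qed.

Lemma mem_row_order s : (s \in row_order n L K) = (s \in K n).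
Proof. by rewrite mem_cat !mem_filter -andb_orl orbN mem_by_index. Qed.

Lemma row_order_uniq : uniq (row_order n L K).
Proof.
rewrite cat_uniq !filter_uniq ?by_index_uniq //= andbT.
by apply/hasPn=> s; rewrite !mem_filter => /andP[/negbTE->].
Qed.

Hypothesis LK : L n \subset K n.
Local Notation rank := (row_rank (row_order n L K)).

(** This is the effect of reordering the rows: those of [L] form an initial segment, sorted by
    index. *)
Lemma row_rank_subcomplex s t : t \in L n -> (rank s <= rank t)%N ->
  s \in L n /\ (idx s <= idx t)%N.
Proof.
set A := [seq s <- by_index n K | s \in L n].
move=> tL; have tA : t \in A by rewrite mem_filter tL mem_by_index (subsetP LK).
have tlt : (index t A < size A)%N by rewrite index_mem.
rewrite /row_rank /row_order -catA !index_cat -/A tA.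
case: ifP => [sA le | _ le]; last by move: (leq_ltn_trans le tlt); rewrite ltnNge leq_addr.
split; first by move: sA; rewrite mem_filter => /andP[].
exact: index_by_index le.
Qed.

Lemma row_rank_mono s t : s \in L n -> t \in L n -> (idx s <= idx t)%N ->
  (rank s <= rank t)%N.
Proof.
move=> sL tL le; rewrite leqNgt; apply/negP=> lt.
have [_ le'] := row_rank_subcomplex sL (ltnW lt).
have e : idx s = idx t by apply/eqP; rewrite eqn_leq le.
by move/(simplex_index_inj hK): e lt => -> //; rewrite ?ltnn ?(subsetP LK).
Qed.

End Orders.

(** * Barcodes read off a reduced matrix *)

Section ReducedMatrix.
Variables (V : finType) (n : nat) (L X K : nat -> {set {set V}}) (k : nat).
Implicit Types (s t : {set V}) (c : chain V).
Local Notation idx := (simplex_index n K).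
Local Notation rank := (row_rank (row_order n L K)).
Local Notation cols := (col_order n K k).
Hypothesis hK : simplexwise_filtration n K.
Hypothesis LK : L n \subset K n.
Hypothesis XK : X n \subset K n.
Hypothesis Xcomplex : forall i, (i <= n)%N -> simplicial_complex (X i).
Hypothesis mem_X : forall s i, (i <= n)%N -> (s \in X i) = (s \in X n) && (idx s <= i)%N.
Hypothesis mem_L : forall s i, (i <= n)%N -> (s \in L i) = (s \in L n) && (idx s <= i)%N.
Variables M B : labelled_matrix {set V}.
Hypothesis M_col : forall t, t \in cols ->
  M t = if t \in X n then simplex_boundary t else 0.
Hypothesis redB : reduce (row_order n L K) cols M B.

(** Each nonzero column of [M] is the boundary of a simplex of [X]; the chain [u] may mix k- and
    (k+1)-simplices. *)
Lemma colspan_boundaryP i c :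
  c \in colspan cols idx M i <->
  exists2 u : chain V, c = boundary V u &
    forall s, u s != 0 -> [/\ s \in cols, s \in X n & (idx s < i)%N].
Proof.
pose A := [seq s <- cols | (s \in X n) && (idx s < i)%N].
split=> [|[u -> hu]].
  have /subvP sub : (colspan cols idx M i <= boundary V @: <<map (@simplex_chain V) A>>)%VS.
    apply: colspan_subv => t tc ti; rewrite M_col //.
    case: ifP => tX; last exact: mem0v.
    by rewrite -boundary_simplex memv_img // memv_span // map_f // mem_filter tX ti.
  move=> /sub/memv_imgP[u /mem_simplex_span uA ->]; exists u => // s /uA.
  by rewrite mem_filter -andbA => /and3P[].
rewrite [u]chain_sum linear_sum memv_suml // => s _.
have [-> | /hu[sc sX si]] := eqVneq (u s) 0; first by rewrite scale0r linear0 mem0v.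
rewrite linearZ memvZ //= boundary_simplex.
by have := mem_colspan M sc si; rewrite M_col // sX.
Qed.

Lemma colspan_reduced i : colspan cols idx B i = colspan cols idx M i.
Proof. by have [_ ->] := reduce_colspan (col_order_lt hK (k := k)) redB. Qed.

Lemma reduced_col t : t \in cols -> B t \in colspan cols idx M (idx t).+1.
Proof. by move=> tc; rewrite -colspan_reduced mem_colspan. Qed.

(** Taking the degree part removes the boundaries of the k-simplices from the combination, so that
    only (k+1)-simplices of [X i] contribute. *)
Lemma colspan_degree_part i c : (i <= n)%N -> c \in colspan cols idx M i.+1 ->
  degree_part k.+1 c \in boundaries k (X i).
Proof.
move=> le_in /colspan_boundaryP[u -> hu].
rewrite -boundary_degree_part memv_img //; apply/mem_chains=> s.
rewrite ffunE; case: ifP => [/eqP -> /hu[_ sX si] | _]; last by rewrite eqxx.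
by rewrite mem_X // sX.
Qed.

Lemma boundaries_colspan i : (i <= n)%N ->
  (boundaries k (X i) <= colspan cols idx M i.+1)%VS.
Proof.
move=> le_in; apply/subvP=> _ /memv_imgP[u /mem_chains hu ->].
apply/colspan_boundaryP; exists u => // s /hu[].
rewrite mem_X // => /andP[sX si] cs; split=> //.
by rewrite mem_col_order cs eqxx orbT (subsetP XK).
Qed.

Lemma reduced_support t s : t \in cols -> B t s != 0 -> s \in row_order n L K.
Proof.
move=> tc; have /colspan_boundaryP[u -> hu] := reduced_col tc.
move/(boundary_support (Xcomplex (leqnn n)))=> [|r [_ _ _ sX]].
  by move=> r /hu[].
by rewrite mem_row_order (subsetP XK).
Qed.

Lemma pivot_leading t s : t \in cols ->
  (pivot (row_order n L K) (B t) == Some s) = leading rank (B t) s.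
Proof.
move=> tc; apply: pivotP; first exact: row_order_uniq.
by move=> r; apply: reduced_support.
Qed.

Lemma reduced_distinct i :
  distinct_leading rank [seq u <- cols | (idx u < i)%N] B.
Proof.
have [rB _ _] := reduce_colspan (col_order_lt hK (k := k)) redB.
by apply: reduced_distinct_leading rB _; [exact: row_order_uniq | exact: reduced_support].
Qed.

Lemma colspan_leading i c : c \in colspan cols idx M i -> c != 0 ->
  exists t r, [/\ t \in cols, (idx t < i)%N, leading rank (B t) r & leading rank c r].
Proof.
rewrite -colspan_reduced => cM c0.
have ucols : uniq [seq u <- cols | (idx u < i)%N] by rewrite !filter_uniq ?by_index_uniq.
have [t [r [+ Br cr]]] :=
  leading_span (@row_rank_inj _ (row_order n L K)) ucols (@reduced_distinct i) cM c0.
by rewrite mem_filter => /andP[ti tc]; exists t, r.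
Qed.

Lemma leading_subcomplex c s t : s \in L n -> leading rank c s -> c t != 0 ->
  t \in L n /\ (idx t <= idx s)%N.
Proof. by move=> sL /leadingP[_ cm] /cm; apply: row_rank_subcomplex. Qed.

Lemma leading_cycle i c s : (i <= n)%N -> s \in L n -> (idx s <= i)%N ->
  leading rank c s -> c \in cycles k (L n) -> c \in cycles k (L i).
Proof.
move=> le_in sL si cs /memv_capP[/mem_chains cL ck]; apply/memv_capP; split=> //.
apply/mem_chains=> t ct; have [tL ts] := leading_subcomplex sL cs ct.
by have [_ ->] := cL t ct; rewrite mem_L // tL (leq_trans ts).
Qed.

Lemma leading_degree_part c s : #|s| = k.+1 -> leading rank c s ->
  leading rank (degree_part k.+1 c) s.
Proof.
move=> sk /leadingP[cs cm]; apply/leadingP; split; first by rewrite ffunE sk eqxx.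
by move=> t; rewrite ffunE; case: ifP => _; [exact: cm | rewrite eqxx].
Qed.

(** The column is a chain of [L] because its leading row is in [L]; its degree part is a boundary in
    [X], hence a cycle, and keeps the leading row since [s] is a k-simplex. *)
Lemma pivot_cycle s t (z := degree_part k.+1 (B t)) :
    s \in L n -> #|s| = k.+1 -> t \in cols -> leading rank (B t) s ->
  [/\ leading rank z s, z \in cycles k (L n), z \in boundaries k (X (idx t))
    & (idx s < idx t <= n)%N].
Proof.
move=> sL sk tc Bs; have zs : leading rank z s by apply: leading_degree_part.
have tn : (idx t <= n)%N.
  by apply: simplex_index_le => //; move: tc; rewrite mem_col_order => /andP[].
have zX := colspan_degree_part tn (reduced_col tc); split=> //.
  apply/memv_capP; split.
    apply/mem_chains=> r; rewrite ffunE; case: ifP => [/eqP-> Br | _]; last by rewrite eqxx.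
    by have [-> _] := leading_subcomplex sL Bs Br.
  by rewrite memv_ker; have /memv_imgP[u _ ez] := zX; rewrite /z ez boundary_boundary.
(* Death comes strictly after birth: [s] is a proper face of some [r] of [X] with index at most that
   of [t]. *)
rewrite tn andbT; have /leadingP[zs0 _] := zs.
have /memv_imgP[u /mem_chains hu ez] := zX; move: zs0; rewrite /z ez.
move/(boundary_support (Xcomplex tn))=> [r /hu[] // | r [rX _ rs _]].
have rXn : r \in X n by move: rX; rewrite mem_X // => /andP[].
have /and3P[s0 sr /eqP cr] := rs.
have ri : (idx r <= n)%N by rewrite simplex_index_le ?(subsetP XK).
have ssr : (idx s <= idx r)%N.
  have : s \in X (idx r).
    have [_ XS] := Xcomplex ri; apply: XS sr s0.
    by rewrite mem_X // rXn leqnn.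
  by rewrite mem_X // => /andP[].
apply: leq_trans (_ : (idx r <= idx t)%N); last by move: rX; rewrite mem_X // => /andP[].
rewrite ltn_neqAle ssr andbT; apply/eqP=> e.
have er : s = r := simplex_index_inj hK (subsetP LK _ sL) (subsetP XK _ rXn) e.
by move: cr; rewrite er; apply: n_Sn.
Qed.

(** The choice made in [death_value], kept as a simplex so that both its index and its value can be
    read. *)
Definition killer s : option {set V} :=
  [pick t in cols | pivot (row_order n L K) (B t) == Some s].

Lemma killerP s t : killer s = Some t -> t \in cols /\ leading rank (B t) s.
Proof.
rewrite /killer; case: pickP => // u /andP[uc pu] [<-].
by rewrite -pivot_leading.
Qed.

Lemma killer_leading s t : t \in cols -> leading rank (B t) s -> killer s = Some t.
Proof.
move=> tc Bs; case e: (killer s) => [u|].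
  have [uc Bu] := killerP e; congr Some.
  (* A bound that puts both columns in one initial segment, where leading rows are distinct. *)
  pose m := (maxn (idx u) (idx t)).+1.
  apply: (@reduced_distinct m _ _ _ _ s) => //.
    by rewrite mem_filter uc ltnS leq_maxl.
  by rewrite mem_filter tc ltnS leq_maxr.
move: e; rewrite /killer; case: pickP => // /(_ t).
by rewrite tc pivot_leading // Bs.
Qed.

(** A zero column says that the boundary of [s] is a combination of earlier columns, which gives a
    cycle led by [s]. Conversely such a cycle puts [B s] in the span of the earlier columns, and a
    nonzero [B s] would share its leading row with one of them. *)
Lemma reduced_col_eq0 s : X n = L n -> s \in L n -> #|s| = k.+1 ->
  B s = 0 <-> exists2 c, c \in cycles k (L n) & leading rank c s.
Proof.
move=> XL sL sk.
have sc : s \in cols by rewrite mem_col_order sk eqxx (subsetP LK).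
have Ms : M s = boundary V (simplex_chain s) by rewrite M_col // XL sL boundary_simplex.
have [_ _ /(_ s sc) diffB] := reduce_colspan (col_order_lt hK (k := k)) redB.
split=> [Bs0 | [c cZ cs]].
  move: diffB; rewrite Bs0 sub0r rpredN => /colspan_boundaryP[u Mu hu].
  (* The chain [u] may contain (k+1)-simplices; the degree part removes them. *)
  exists (degree_part k.+1 (simplex_chain s - u)).
    apply/memv_capP; split.
      apply/mem_chains=> t; rewrite ffunE; case: ifP => [/eqP-> ct | _]; last by rewrite eqxx.
      split=> //; apply: contraR ct => tL; rewrite !ffunE.
      have [e | _] := eqVneq t s; first by rewrite e sL in tL.
      rewrite sub0r oppr_eq0; apply: contraR tL => /hu[_]; by rewrite XL.
    by rewrite memv_ker boundary_degree_part linearB /= -Ms -Mu subrr linear0.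
  apply: leading_degree_part => //; apply/leadingP; split=> [|t].
    rewrite !ffunE eqxx; have [-> | /hu[_ _]] := eqVneq (u s) 0; last by rewrite ltnn.
    by rewrite subr0 oner_neq0.
  rewrite !ffunE; have [-> // | _] := eqVneq t s.
  rewrite sub0r oppr_eq0 => /hu[_]; rewrite XL => tL ts.
  exact: row_rank_mono (ltnW ts).
(* Scaling [c] to have coefficient 1 at [s] leaves in [u] only simplices before [s], and subtracting
   a cycle does not change the boundary. *)
pose u := simplex_chain s - (c s)^-1 *: c.
have /leadingP[cs0 _] := cs; have /memv_capP[/mem_chains cL ck] := cZ.
have Mu : M s = boundary V u.
  rewrite linearB linearZ /= -Ms; move: ck; rewrite memv_ker => /eqP->.
  by rewrite scaler0 subr0.
have uE t : u t = (t == s)%:R - (c s)^-1 * c t by rewrite !ffunE.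
have MM : M s \in colspan cols idx M (idx s).
  apply/colspan_boundaryP; exists u => // t; rewrite uE.
  have [-> | nts] := eqVneq t s; first by rewrite mulVf // subrr eqxx.
  rewrite sub0r oppr_eq0 mulf_eq0 negb_or => /andP[_ ct].
  have [tL ts] := leading_subcomplex sL cs ct; have [_ tk] := cL t ct.
  rewrite XL mem_col_order tk eqxx (subsetP LK) //; split=> //.
  rewrite ltn_neqAle ts andbT; apply: contra nts => /eqP e.
  by apply/eqP; exact: (simplex_index_inj hK (subsetP LK _ tL) (subsetP LK _ sL) e).
have BB : B s \in colspan cols idx M (idx s) by rewrite -(subrK (M s) (B s)) memvD.
apply/eqP; apply: contraT => /(colspan_leading BB)[t [r [tc ts Bt Bs]]].
have e : t = s.
  apply: (@reduced_distinct (idx s).+1 _ _ _ _ r) => //; rewrite mem_filter ltnS.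
    by rewrite (ltnW ts).
  by rewrite leqnn.
by rewrite e ltnn in ts.
Qed.

Variables (P : pmodule 'F_2) (q : forall i, 'Hom(chain V, pspace P i)) (S : seq {set V}).
Hypothesis Suniq : uniq S.
Hypothesis S_cycle : forall s, s \in S <->
  [/\ s \in L n, #|s| = k.+1 & exists2 c, c \in cycles k (L n) & leading rank c s].
Hypothesis q_full : forall i, (1 <= i <= n)%N -> (q i @: cycles k (L i))%VS = fullv.
Hypothesis q_ker : forall i c, (1 <= i <= n)%N -> c \in cycles k (L i) ->
  (q i c == 0) = (c \in boundaries k (X i)).
Hypothesis q_map : forall i c, (1 <= i < n)%N -> c \in cycles k (L i) ->
  Defs.pmap P i (q i c) = q i.+1 c.

Lemma subX i j : (i <= j <= n)%N -> X i \subset X j.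
Proof.
move=> /andP[ij jn]; apply/subsetP=> s.
rewrite (mem_X _ (leq_trans ij jn)) (mem_X _ jn) => /andP[-> si].
exact: leq_trans ij.
Qed.

(** Membership in [S] stands under the existential so that finite choice gives a function on all
    sets. The witness is the degree part of the killing column if there is one, else any cycle led
    by [s]. *)
Lemma exists_representative s : exists z, s \in S ->
  [/\ leading rank z s, z \in cycles k (L n)
    & forall t, killer s = Some t ->
      z \in boundaries k (X (idx t)) /\ (idx s < idx t <= n)%N].
Proof.
have [/S_cycle[sL sk [c cL cs]] | nS] := boolP (s \in S); last by exists 0.
case e: (killer s) => [t|]; last by exists c.
have [tc Bs] := killerP e; have [zs zL zX st] := pivot_cycle sL sk tc Bs.
by exists (degree_part k.+1 (B t)) => _; split=> // _ [<-].
Qed.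

(** The representatives form an adapted basis: by [span_leading] it is enough to meet every leading
    row of a cycle, respectively of a cycle that bounds in [X i]. *)
Lemma reduced_barcode :
  is_barcode n P [seq (idx s, omap idx (killer s)) | s <- S].
Proof.
have [z zP] := fin_all_exists exists_representative.
have SL s : s \in S -> s \in L n by case/S_cycle.
have S_K s : s \in S -> s \in K n by move/SL/(subsetP LK).
have cycle_lead i c s : (i <= n)%N -> c \in cycles k (L i) -> leading rank c s ->
    s \in S /\ (idx s <= i)%N.
  move=> le_in cZ cs; have /leadingP[cs0 _] := cs.
  have /memv_capP[/mem_chains/(_ s cs0)[sLi sk] _] := cZ.
  move: sLi; rewrite mem_L // => /andP[sL si]; split=> //.
  apply/S_cycle; split=> //; exists c => //; apply: subvP cZ; apply: cyclesS.
  by apply/subsetP=> t; rewrite mem_L // => /andP[].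
have zZ i s : (i <= n)%N -> s \in S -> (idx s <= i)%N -> z s \in cycles k (L i).
  move=> le_in sS si; have [zs zL _] := zP s sS.
  exact: leading_cycle (SL s sS) si zs zL.
apply: (@barcode_of_adapted_basis _ P _ q _ _ z n S (fun i => cycles k (L i))) => //.
- apply/allP=> _ /mapP[s sS ->]; rewrite /valid_bar /=.
  have sK := S_K s sS.
  rewrite simplex_index_gt0 ?simplex_index_le //.
  have [_ _] := zP s sS; case: (killer s) => //= t /(_ t erefl)[_ ->]; exact: isT.
- apply: (leading_free (@row_rank_inj _ (row_order n L K))) => //.
    move=> s t sS tS r zs zt; have [zs' _ _] := zP s sS; have [zt' _ _] := zP t tS.
    rewrite (leading_uniq (@row_rank_inj _ _) zs' zs).
    by rewrite (leading_uniq (@row_rank_inj _ _) zt' zt).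
  by move=> s sS; have [zs _ _] := zP s sS; exact: leading_neq0 zs.
- move=> i /andP[_ le_in]; apply/eqP; rewrite eqEsubv; apply/andP; split.
    apply: (span_leading (@row_rank_inj _ (row_order n L K))) => c s cZ cs.
    have [sS si] := cycle_lead i c s le_in cZ cs; have [zs _ _] := zP s sS.
    by exists (z s); rewrite zZ // map_f // mem_filter si.
  apply/span_subvP=> _ /mapP[s + ->]; rewrite mem_filter => /andP[si sS].
  exact: zZ.
- move=> i iP; have /andP[_ le_in] := iP; apply/eqP; rewrite eqEsubv; apply/andP; split.
    apply: (span_leading (@row_rank_inj _ (row_order n L K))) => c s.
    rewrite memv_cap memv_ker => /andP[cZ]; rewrite q_ker // => cX cs.
    have [sS si] := cycle_lead i c s le_in cZ cs; have [zs _ zX] := zP s sS.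
    (* The leading row [s] of a bounding cycle is that of a column [t] with index at most [i]; this
       [t] kills [s], so [z s] bounds in [X i] too. *)
    have := subvP (boundaries_colspan le_in) _ cX.
    move/colspan_leading/(_ (leading_neq0 cs))=> [t [r [tc ti Bt cr]]].
    rewrite -(leading_uniq (@row_rank_inj _ _) cs cr) in Bt.
    have e := killer_leading tc Bt; have [zXt _] := zX t e.
    have zsZ := zZ i s le_in sS si.
    exists (z s); split; last exact: zs.
      by apply: map_f; rewrite mem_filter sS andbT /in_death /= e.
    rewrite memv_cap zsZ memv_ker (q_ker iP zsZ).
    by apply: subvP zXt; apply: boundariesS; apply: subX; rewrite le_in andbT.
  apply/span_subvP=> _ /mapP[s + ->]; rewrite mem_filter => /andP[+ sS].
  rewrite /in_death /=; case e: (killer s) => [t|] //= ti.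
  have [_ _ /(_ t e)[zX /andP[st _]]] := zP s sS.
  have zsZ := zZ i s le_in sS (leq_trans (ltnW st) ti).
  rewrite memv_cap zsZ memv_ker (q_ker iP zsZ).
  by apply: subvP zX; apply: boundariesS; apply: subX; rewrite ti.
Qed.

End ReducedMatrix.

(** * Homology modules and the theorem *)

Section HomologyModules.
Variables (V : finType) (n k : nat) (L K : nat -> {set {set V}}).
Hypothesis LS : forall i, (i < n)%N -> L i \subset L i.+1.
Hypothesis KS : forall i, (i < n)%N -> K i \subset K i.+1.
Hypothesis LK : forall i, (i <= n)%N -> L i \subset K i.

Lemma homology_class_is_linear X : linear (@homology_class V k X).
Proof. move=> a c d; rewrite /homology_class linearP; exact: quotv_class_is_linear. Qed.

(** Defined on all chains, so that the domain does not depend on [i]; meaningful on cycles only. *)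
Definition class_map i : 'Hom(chain V, homology k (L i)) := linfun (homology_class k (L i)).

Lemma class_mapE i c : class_map i c = homology_class k (L i) c.
Proof. exact: linfunE (@homology_class_is_linear (L i)). Qed.

Lemma homology_class_eq0 X (c : chain V) : c \in cycles k X ->
  (homology_class k X c == 0) = (c \in boundaries k X).
Proof.
by move=> cX; rewrite /homology_class quotv_class_eq0 -memv_preim lfunE /= vsprojK.
Qed.

Lemma class_map_full i : (class_map i @: cycles k (L i))%VS = fullv.
Proof.
apply/eqP; rewrite eqEsubv subvf; apply/subvP=> x _.
by have [c cL ->] := homology_classP x; rewrite -class_mapE memv_img.
Qed.

Lemma class_map_pmap i (c : chain V) : (1 <= i < n)%N -> c \in cycles k (L i) ->
  Defs.pmap (homology_pmodule k L) i (class_map i c) = class_map i.+1 c.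
Proof.
by move=> /andP[_ lin] cL; rewrite !class_mapE /= homology_mapE // LS.
Qed.

Local Notation phi := (fun i => homology_map k (L i) (K i)).

Definition image_class_map i : 'Hom(chain V, subvs_of (limg (phi i))) :=
  linfun (fun c => vsproj (limg (phi i)) (phi i (class_map i c))).

Lemma image_class_mapE i c :
  vsval (image_class_map i c) = phi i (homology_class k (L i) c).
Proof.
rewrite linfunE ?vsprojK ?memv_img ?memvf ?class_mapE //.
by move=> a u v; rewrite !linearP.
Qed.

Lemma vsval_image_class_map i (c : chain V) : (i <= n)%N -> c \in cycles k (L i) ->
  vsval (image_class_map i c) = homology_class k (K i) c.
Proof.
by move=> le_in cL; rewrite image_class_mapE homology_mapE // LK.
Qed.

(** The image is a subspace of the homology of [K i], where a cycle vanishes only if it bounds in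
    [K i]. *)
Lemma image_class_map_ker i (c : chain V) : (i <= n)%N -> c \in cycles k (L i) ->
  (image_class_map i c == 0) = (c \in boundaries k (K i)).
Proof.
move=> le_in cL; have cK := subvP (cyclesS k (LK le_in)) _ cL.
rewrite -homology_class_eq0 // -vsval_image_class_map //.
Qed.

Lemma image_class_map_full i : (image_class_map i @: cycles k (L i))%VS = fullv.
Proof.
apply/eqP; rewrite eqEsubv subvf; apply/subvP=> x _.
have /memv_imgP[y _ xy] := subvsP x.
have [c cL yc] := homology_classP y.
have -> : x = image_class_map i c; last by rewrite memv_img.
by apply: val_inj; rewrite [RHS]image_class_mapE -yc.
Qed.

Lemma image_class_map_pmap i (c : chain V) : (1 <= i < n)%N -> c \in cycles k (L i) ->
  Defs.pmap (image_pmodule k L K) i (image_class_map i c) = image_class_map i.+1 c.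
Proof.
move=> /andP[_ lin] cL; rewrite /= linfunE; last by move=> a u v; rewrite !linearP.
have cL1 := subvP (cyclesS k (LS lin)) _ cL.
rewrite vsval_image_class_map ?(ltnW lin) //.
rewrite homology_mapE ?KS //; last exact: subvP (cyclesS k (LK (ltnW lin))) _ cL.
apply: val_inj; rewrite [RHS]vsval_image_class_map // [LHS]vsprojK //.
(* The projection fixes this class, which comes from a cycle of [L i.+1] and so lies in the
   image. *)
by rewrite -vsval_image_class_map // subvsP.
Qed.

End HomologyModules.

(** Serves for the matching: births are distinct, so the filter in [index_mixup_triples] finds only
    the bar of the same simplex. *)
Lemma filter_map_uniq (T1 T2 : eqType) (T3 : Type) (s : seq T1) (h : T1 -> T2)
    (g : T1 -> T3) x : uniq s -> {in s &, injective h} -> x \in s ->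
  [seq j <- [seq (h y, g y) | y <- s] | j.1 == h x] = [:: (h x, g x)].
Proof.
move=> us hinj xs; rewrite filter_map -[RHS]/(map (fun y => (h y, g y)) [:: x]).
congr map; rewrite -(filter_pred1_uniq us xs); apply: eq_in_filter => y ys /=.
by apply/eqP/eqP=> [/hinj -> // | ->].
Qed.

Theorem theorem10 (R : realType) (V : finType) (n : nat)
    (L K : nat -> {set {set V}}) (f : {set V} -> R) (k : nat)
    (hL : simplexwise_filtration n L) (hK : simplexwise_filtration n K)
    (hLK : filtration_inclusion n L K) (hf : order_preserving n K f)
    (T : seq (R * \bar R * \bar R)) (hT : algorithmM_returns n L K f k T) :
  is_mixup_barcode n L K f k T.
Proof.
have [BL [BK [redL redK ->]]] := hT.
have [LKi _] := hLK; have LK := LKi n (leqnn n).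
have [_ Lc LS _] := hL; have [_ Kc KS _] := hK.
have mem_K s i : (i <= n)%N -> (s \in K i) = (s \in K n) && (simplex_index n K s <= i)%N.
  move=> le_in; have [sK | sK] := boolP (s \in K n); first exact: mem_filtration.
  by apply: contraNF sK; apply/subsetP/(filtrationS hK); rewrite le_in leqnn.
have mem_L s i : (i <= n)%N -> (s \in L i) = (s \in L n) && (simplex_index n K s <= i)%N.
  move=> le_in; have [sL | sL] := boolP (s \in L n); first exact: (mem_subfiltration hL hK hLK).
  by apply: contraNF sL; apply/subsetP/(filtrationS hL); rewrite le_in leqnn.
have colK t : t \in col_order n K k ->
    initial_BK n K k t = if t \in K n then simplex_boundary t else 0.
  by move=> tc; rewrite ffunE tc; move: tc; rewrite mem_col_order => /andP[_ ->].
(* Zeroing rows does not touch the column of a simplex of [L], since its facets are in [L]. *)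
have colL t : t \in col_order n K k ->
    initial_BL n L K k t = if t \in L n then simplex_boundary t else 0.
  move=> tc; apply/ffunP=> s; rewrite !ffunE tc.
  case: ifP => [/andP[_ ->] // | nLs]; case: ifP => [tL | _]; last by rewrite ffunE.
  rewrite ffunE; case: (boolP (facet s t)) => // /and3P[s0 st _].
  by have [_ /(_ _ _ tL st s0) sL] := Lc n (leqnn n); rewrite sL tL in nLs.
(* The births are read off [BL] and index both barcodes, that of the image included. *)
pose S := [seq s : {set V} <- by_index n K | [&& s \in L n, #|s| == k.+1 & BL s == 0]].
have Suniq : uniq S by rewrite filter_uniq ?by_index_uniq.
have S_cycle s : s \in S <-> [/\ s \in L n, #|s| = k.+1
    & exists2 c, c \in cycles k (L n) & leading (row_rank (row_order n L K)) c s].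
  have eq0 := reduced_col_eq0 hK LK LK Lc colL redL (s := s) erefl.
  rewrite mem_filter mem_by_index; split.
    by case/andP=> /and3P[sL /eqP sk /eqP B0] _; split=> //; apply/eq0.
  by case=> sL sk cs; rewrite sL sk eqxx (subsetP LK) //= andbT; apply/eqP/eq0.
pose bars B := [seq (simplex_index n K s,
  omap (simplex_index n K) (killer n L K k B s)) | s <- S].
exists (bars BL), (bars BK); split.
- apply: (reduced_barcode hK LK LK Lc mem_L mem_L colL redL 
    (P := homology_pmodule k L) (q := class_map k L)) => //.
  + by move=> i _; apply: class_map_full.
  + by move=> i c _ cL; rewrite class_mapE homology_class_eq0.
  + by move=> i c; apply: class_map_pmap.
(* For the image, cycles are still taken in [L] but boundaries in [K]. *)
- apply: (reduced_barcode hK LK (subxx _) Kc mem_K mem_L colK redK 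
    (P := image_pmodule k L K) (q := image_class_map k L K)) => //.
  + by move=> i _; apply: image_class_map_full.
  + by move=> i c /andP[_ le_in] cL; apply: image_class_map_ker LKi _ _ _ _.
  + by move=> i c; apply: image_class_map_pmap.
have S_K s : s \in S -> s \in K n by move/S_cycle=> [sL _ _]; apply: (subsetP LK).
(* A missing killer gives [None], hence the infinite value on both sides. *)
have death_valueE B s : death_value n L K f k B s =
    index_evalue K f (omap (simplex_index n K) (killer n L K k B s)).
  rewrite /death_value /killer; case: pickP => [t /andP[+ _] | //] /=.
  by rewrite mem_col_order => /andP[_ tK]; rewrite index_value_step.
(* Both sides list [S] in the same order, so the permutation is an equality. *)
have -> : [seq value_triple K f t | t <- index_mixup_triples (bars BL) (bars BK)] =
    algorithmM_output n L K f k BL BK; last exact: perm_refl.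
rewrite /algorithmM_output -/S /index_mixup_triples -!map_comp.
apply/eq_in_map => s sS /=.
rewrite filter_map_uniq //; last first.
  by move=> x y /S_K xK /S_K yK; apply: simplex_index_inj.
by rewrite /value_triple /= index_value_step ?S_K // -!death_valueE.
Qed.
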